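(* Let $\Sigma$ be a set of equations in a finitary algebraic signature and let $n\ge 2$ be an integer. If the variety $\mathcal{V}(\Sigma)$ is $n$-permutable, then the free-algebra functor $F_\Sigma:\mathrm{Set}\to\mathrm{Set}$ weakly preserves kernel pairs if and only if $\mathcal{V}(\Sigma)$ is a Mal'cev variety, i.e. $2$-permutable.
   Context: $\mathcal{V}(\Sigma)$ is the class of all algebras satisfying $\Sigma$. It is $n$-permutable if for all congruences $\Theta,\Psi$ of each algebra in $\mathcal{V}(\Sigma)$ one has $\Theta\circ\Psi\circ\Theta\circ\cdots=\Psi\circ\Theta\circ\Psi\circ\cdots$, where each side is the relational composition of $n$ alternating factors. (Hagemann–Mitschke: this is equivalent to the existence of ternary terms $p_1,\dots,p_{n-1}$ such that $x\approx p_1(x,y,y)$, $p_i(x,x,y)\approx p_{i+1}(x,y,y)$ for all $0<i<n-1$, and $p_{n-1}(x,x,y)\approx y$ hold in $\mathcal{V}(\Sigma)$.) $\mathcal{V}(\Sigma)$ is a Mal'cev variety if there is a ternary term $m$ with $m(x,y,y)\approx x$ and $m(x,x,y)\approx y$ in $\mathcal{V}(\Sigma)$; equivalently it is $2$-permutable. For a set $X$, $F_\Sigma(X)$ is (the underlying set of) the free $\Sigma$-algebra over $X$: terms with variables from $X$, where $p,q$ are identified iff $p\approx q$ is a consequence of $\Sigma$. For $\varphi:X\to Y$, $F_\Sigma\varphi$ is variable substitution $p(x_1,\dots,x_k)\mapsto p(\varphi x_1,\dots,\varphi x_k)$. The axiom of choice is assumed. A functor $F:\mathrm{Set}\to\mathrm{Set}$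 weakly preserves kernel pairs if for every map $f:A\to C$, with kernel pair (pullback of $f$ with itself) $(K,\pi_1,\pi_2)$, and all $u_1,u_2\in F(A)$ with $(Ff)u_1=(Ff)u_2$ there is $w\in F(K)$ with $(F\pi_1)w=u_1$ and $(F\pi_2)w=u_2$. *)

(* Defs.v *)
From mathcomp Require Import all_boot.
From mathcomp Require Import boolp classical_sets.

Set Implicit Arguments.
Unset Strict Implicit.
Unset Printing Implicit Defensive.

Local Open Scope classical_set_scope.
Local Open Scope relation_scope.
Local Open Scope quotient_scope.

Record signature := Signature {
  op : Type;
  arity : op -> nat }.

Inductive term (S : signature) (X : Type) : Type :=
| Var of X
| App (f : op S) of 'I_(arity f) -> term S X.

Arguments Var {S X} x.
Arguments App {S X} f ts.

Fixpoint rename (S : signature) (X Y : Type) (phi : X -> Y) (t : term S X) :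
    term S Y :=
  match t with
  | Var x => Var (phi x)
  | App f ts => App f (fun i => rename phi (ts i))
  end.

(* The carrier may be empty. *)
Record algebra (S : signature) := Algebra {
  carrier :> Type;
  interp : forall f : op S, ('I_(arity f) -> carrier) -> carrier }.

Fixpoint eval (S : signature) (A : algebra S) (X : Type) (v : X -> A)
    (t : term S X) : A :=
  match t with
  | Var x => v x
  | App f ts => interp (fun i => eval v (ts i))
  end.

(* Terms are finitary, so countably many variables suffice for equations. *)
Definition equation (S : signature) : Type := (term S nat * term S nat)%type.

Definition models (S : signature) (A : algebra S) (X : Type)
    (p q : term S X) : Prop :=
  forall v : X -> A, eval v p = eval v q.

(* The class V(Sigma). It is not typed as a set (algebra S): this would place
   algebra S below the universe of library types, and the library quotient
   that is the carrier of a free algebra would be too large to be a carrier. *)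
Definition variety (S : signature) (Sigma : set (equation S))
    (A : algebra S) : Prop :=
  forall e, Sigma e -> models A e.1 e.2.

(* p ~ q holds in V(Sigma), i.e. is a (semantic) consequence of Sigma. *)
Definition consequence (S : signature) (Sigma : set (equation S)) (X : Type)
    (p q : term S X) : Prop :=
  forall A, variety Sigma A -> models A p q.

Definition compatible (S : signature) (A : algebra S) (Theta : set (A * A)) :
    Prop :=
  forall (f : op S) (a b : 'I_(arity f) -> A),
    (forall i, Theta (a i, b i)) -> Theta (interp a, interp b).

Record congruence (S : signature) (A : algebra S) (Theta : set (A * A)) :
    Prop := Congruence {
  congr_refl : forall x, Theta (x, x);
  congr_sym : forall x y, Theta (x, y) -> Theta (y, x);
  congr_trans : forall x y z, Theta (x, y) -> Theta (y, z) -> Theta (x, z);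
  congr_compat : compatible Theta }.

(* The composite R o S o R o ... of n alternating factors, read from left to
   right: in the library notation, B \; A relates along A first, then B. *)
Fixpoint alternating (T : Type) (n : nat) (R S : set (T * T)) : set (T * T) :=
  match n with
  | 0 => diagonal
  | 1 => R
  | m.+1 => alternating m S R \; R
  end.

Definition permutable (S : signature) (Sigma : set (equation S)) (n : nat) :
    Prop :=
  forall A : algebra S, variety Sigma A ->
  forall Theta Psi : set (A * A), congruence Theta -> congruence Psi ->
    alternating n Theta Psi = alternating n Psi Theta.

Definition ternary (S : signature) (A : algebra S) (m : term S 'I_3)
    (a b c : A) : A :=
  eval (tnth [tuple a; b; c]) m.

Definition malcev (S : signature) (Sigma : set (equation S)) : Prop :=
  exists m : term S 'I_3, forall A : algebra S, variety Sigma A ->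
  forall x y : A, ternary m x y y = x /\ ternary m x x y = y.

Record set_functor := SetFunctor {
  fobj :> Type -> Type;
  fmap : forall X Y : Type, (X -> Y) -> fobj X -> fobj Y;
  fmap_id : forall X, fmap (@id X) = id;
  fmap_comp : forall X Y Z (g : Y -> Z) (f : X -> Y),
    fmap (g \o f) = fmap g \o fmap f }.

Arguments fmap F {X Y} f : rename.

Definition kernel_pair (A C : Type) (f : A -> C) : Type :=
  {p : A * A | f p.1 = f p.2}.

Definition kerpi1 (A C : Type) (f : A -> C) (k : kernel_pair f) : A :=
  (proj1_sig k).1.

Definition kerpi2 (A C : Type) (f : A -> C) (k : kernel_pair f) : A :=
  (proj1_sig k).2.

Definition weakly_preserves_kernel_pairs (F : set_functor) : Prop :=
  forall (A C : Type) (f : A -> C) (u1 u2 : F A),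
    fmap F f u1 = fmap F f u2 ->
    exists w : F (kernel_pair f),
      fmap F (@kerpi1 A C f) w = u1 /\ fmap F (@kerpi2 A C f) w = u2.

Section FreeAlgebra.
Variables (S : signature) (Sigma : set (equation S)).

Definition conseqb (X : Type) : rel {classic term S X} :=
  fun p q => `[< consequence Sigma p q >].

Lemma conseqb_refl X : reflexive (@conseqb X).
Proof. by move=> p; apply/asboolP. Qed.

Lemma conseqb_sym X : symmetric (@conseqb X).
Proof.
by move=> p q; apply/asboolP/asboolP => h A VA v; rewrite (h A VA v).
Qed.

Lemma conseqb_trans X : transitive (@conseqb X).
Proof.
move=> q p r /asboolP pq /asboolP qr; apply/asboolP => A VA v.
by rewrite (pq A VA v) (qr A VA v).
Qed.

Canonical conseqb_equiv (X : Type) :=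
  EquivRel (@conseqb X) (@conseqb_refl X) (@conseqb_sym X) (@conseqb_trans X).

(* The underlying set of the free algebra over X. *)
Definition free (X : Type) : Type := {eq_quot (@conseqb X)}.

Definition free_class (X : Type) (t : term S X) : free X :=
  \pi_({eq_quot (@conseqb X)}) t.

Definition free_repr (X : Type) (c : free X) : term S X :=
  repr (c : {eq_quot (@conseqb X)}).

Lemma free_reprK X : cancel (@free_repr X) (@free_class X).
Proof. by move=> c; apply: reprK. Qed.

Lemma free_classP X (p q : term S X) :
  free_class p = free_class q <-> consequence Sigma p q.
Proof. by split=> [/eqmodP/asboolP | h]//; apply/eqmodP/asboolP. Qed.

Definition free_algebra (X : Type) : algebra S :=
  @Algebra S (free X)
    (fun f c => free_class (App f (fun i => free_repr (c i)))).

(* Variable substitution; free_mapE is its independence of representatives. *)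
Definition free_map (X Y : Type) (phi : X -> Y) (c : free X) : free Y :=
  free_class (rename phi (free_repr c)).

Lemma eval_rename (A : algebra S) X Y (phi : X -> Y) (v : Y -> A) t :
  eval v (rename phi t) = eval (v \o phi) t.
Proof.
by elim: t => //= f ts IH; congr (interp _); apply/funext => i; apply: IH.
Qed.

Lemma free_mapE X Y (phi : X -> Y) t :
  free_map phi (free_class t) = free_class (rename phi t).
Proof.
apply/free_classP => A VA v; rewrite !eval_rename.
by have /free_classP/(_ A VA (v \o phi)) := free_reprK (free_class t).
Qed.

Lemma free_map_id X : free_map (@id X) = id.
Proof.
apply/funext => c; rewrite -(free_reprK c) free_mapE.
by apply/free_classP => A VA v; rewrite eval_rename.
Qed.

Lemma free_map_comp X Y Z (g : Y -> Z) (f : X -> Y) :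
  free_map (g \o f) = free_map g \o free_map f.
Proof.
apply/funext => c /=; rewrite -(free_reprK c) !free_mapE.
by apply/free_classP => A VA v; rewrite !eval_rename.
Qed.

Definition free_functor : set_functor :=
  SetFunctor free_map_id free_map_comp.

Lemma free_interpE X (f : op S) (ts : 'I_(arity f) -> term S X) :
  @interp S (free_algebra X) f (fun i => free_class (ts i)) =
  free_class (App f ts).
Proof.
apply/free_classP => A VA v /=; congr (interp _); apply/funext => i.
by have /free_classP/(_ A VA v) := free_reprK (free_class (ts i)).
Qed.

Fixpoint subst (X Y : Type) (s : X -> term S Y) (t : term S X) : term S Y :=
  match t with
  | Var x => s x
  | App f ts => App f (fun i => subst s (ts i))
  end.

Lemma eval_subst (A : algebra S) X Y (s : X -> term S Y) (v : Y -> A) t :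
  eval v (subst s t) = eval (fun x => eval v (s x)) t.
Proof.
by elim: t => //= f ts IH; congr (interp _); apply/funext => i; apply: IH.
Qed.

Lemma eval_free X Y (v : X -> free_algebra Y) t :
  eval v t = free_class (subst (fun x => free_repr (v x)) t).
Proof.
elim: t => [x | f ts IH]; first by rewrite /= free_reprK.
transitivity (@interp S (free_algebra Y) f
    (fun i => free_class (subst (fun x => free_repr (v x)) (ts i)))).
  by congr (@interp S (free_algebra Y) f _); apply/funext => i; apply: IH.
exact: free_interpE.
Qed.

Lemma free_algebra_variety X : variety Sigma (free_algebra X).
Proof.
move=> e Se v; rewrite !eval_free; apply/free_classP => A VA w.
by rewrite !eval_subst; apply: VA.
Qed.

Lemma free_algebra_universal X (A : algebra S) (v : X -> A) :
  variety Sigma A ->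
  exists! h : free_algebra X -> A,
    (forall f c, h (@interp S (free_algebra X) f c) = interp (h \o c)) /\
    (forall x, h (free_class (Var x)) = v x).
Proof.
move=> VA; pose h (c : free_algebra X) := eval v (free_repr c).
have hE t : h (free_class t) = eval v t.
  by have /free_classP/(_ A VA v) := free_reprK (free_class t).
exists h; split=> [| g [gf gv]].
  by split=> [f c | x]; [exact: hE | exact: hE].
apply/funext => c; rewrite -(free_reprK c) hE.
elim: (free_repr c) => [x | f ts IH] /=; first by rewrite gv.
by rewrite -free_interpE gf; congr (interp _); apply/funext => i; apply: IH.
Qed.

End FreeAlgebra.

(* Main.v *)
(** A Mal'cev operation is a single step between the generators for the
    relation "some ternary [p] has [p(x,y,y) = s] and [p(x,x,y) = t]" on the
    free algebra over two generators [x], [y]; the Hagemann-Mitschke terms of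
    an n-permutable variety form a chain of [n - 1] such steps from [x] to [y].
    Weak preservation of kernel pairs makes this relation transitive, so the
    chain collapses to one step.  Conversely, if [e] picks a representative in
    each fibre of [f], then the lifting of [u1] and [u2] to the kernel pair is
    [m(w1, w2, w3)], where [w1], [w2], [w3] project to [(u1, Fe u1)],
    [(Fe u1, Fe u1)] and [(Fe u2, u2)], with [Fe u1 = Fe u2]. *)

Require Import Defs.
From mathcomp Require Import all_boot.
From mathcomp Require Import boolp classical_sets.

Set Implicit Arguments.
Unset Strict Implicit.
Unset Printing Implicit Defensive.

Local Open Scope classical_set_scope.

(** With [false] and [true] as x and y, these maps turn p(x,y,z) into p(x,y,y) and p(x,x,y). *)
Definition merge_right (i : 'I_3) : bool := tnth [tuple false; true; true] i.
Definition merge_left (i : 'I_3) : bool := tnth [tuple false; false; true] i.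

Lemma eq_fun_ord3 (T : Type) (f g : 'I_3 -> T) :
  f (inord 0) = g (inord 0) -> f (inord 1) = g (inord 1) ->
  f (inord 2) = g (inord 2) -> f = g.
Proof.
move=> e0 e1 e2; apply/funext => -[[|[|[|//]]] lti].
- by have -> : Ordinal lti = inord 0 by apply/val_inj; rewrite /= inordK.
- by have -> : Ordinal lti = inord 1 by apply/val_inj; rewrite /= inordK.
- by have -> : Ordinal lti = inord 2 by apply/val_inj; rewrite /= inordK.
Qed.

Lemma tnth3 (T : Type) (a b c : T) :
  [/\ tnth [tuple a; b; c] (inord 0) = a, tnth [tuple a; b; c] (inord 1) = b
    & tnth [tuple a; b; c] (inord 2) = c].
Proof. by split; rewrite (tnth_nth a) /= inordK. Qed.

Lemma comp_tnth3 (T U : Type) (f : T -> U) (a b c : T) :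
  f \o tnth [tuple a; b; c] = tnth [tuple f a; f b; f c].
Proof.
have [a0 b0 c0] := tnth3 a b c; have [fa fb fc] := tnth3 (f a) (f b) (f c).
by apply: eq_fun_ord3; rewrite /= ?a0 ?b0 ?c0 ?fa ?fb ?fc.
Qed.

(** * Substitution as a homomorphism; from Mal'cev to kernel pairs *)

Section FreeMap.
Variables (S : signature) (Sigma : set (equation S)).
Local Notation F := (free Sigma).

Lemma free_map_comp_apply X Y Z (g : Y -> Z) (f : X -> Y) (u : F X) :
  free_map g (free_map f u) = free_map (g \o f) u.
Proof. by rewrite free_map_comp. Qed.

Lemma free_map_eval X Y Z (phi : Y -> Z) (v : X -> free_algebra Sigma Y) t :
  free_map phi (eval v t : F Y) =
  eval (free_map phi \o v : X -> free_algebra Sigma Z) t.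
Proof.
elim: t => [//|f ts IH] /=.
transitivity (@interp S (free_algebra Sigma Z) f
    (fun i => free_map phi (eval v (ts i) : F Y))); last first.
  by congr (@interp S (free_algebra Sigma Z) f _); apply/funext.
rewrite free_mapE; apply/free_classP => A VA w /=.
congr (interp _); apply/funext => i; rewrite eval_rename.
have /free_classP/(_ A VA w) -> :=
  free_reprK (free_map phi (eval v (ts i) : F Y)).
by rewrite eval_rename.
Qed.

Lemma free_map_ternary Y Z (phi : Y -> Z) m (a b c : free_algebra Sigma Y) :
  free_map phi (ternary m a b c : F Y) =
  @ternary S (free_algebra Sigma Z) m
    (free_map phi a) (free_map phi b) (free_map phi c).
Proof. by rewrite /ternary free_map_eval comp_tnth3. Qed.

Lemma malcev_wpkp :
  malcev Sigma -> weakly_preserves_kernel_pairs (free_functor Sigma).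
Proof.
move=> [m mP] A C f u1 u2 /= fu.
have ex c : exists r : option A, forall a, f a = c ->
    exists2 a', r = Some a' & f a' = c.
  have [[a fa]|na] := pselect (exists a, f a = c).
    by exists (Some a) => _ _; exists a.
  by exists None => a fa; case: na; exists a.
(* The choice is made on [C], so that [e a] below depends only on [f a]. *)
have [r rP] := choice ex.
pose e a := odflt a (r (f a)).
have fe a : f (e a) = f a by rewrite /e; have [a' -> ->] := rP (f a) a erefl.
have eu : free_map e u1 = free_map e u2.
  move/free_classP: fu => fu; apply/free_classP => B VB v.
  (* [C] may have points outside the image of [f], and [A] may be empty: the
     value of [u1] itself is then the default that extends [v] to [C]. *)
  pose v' c := if r c is Some a then v a else eval v (free_repr u1).
  have ve : v \o e = v' \o f.
    by apply/funext => a; rewrite /v' /e /=; have [a' -> _] := rP (f a) a erefl.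
  by have := fu B VB v'; rewrite !eval_rename ve.
pose K := kernel_pair f.
pose k1 a : K := exist _ (a, e a) (esym (fe a)).
pose k2 a : K := exist _ (e a, e a) erefl.
pose k3 a : K := exist _ (e a, a) (fe a).
have VA := @free_algebra_variety S Sigma A.
exists (@ternary S (free_algebra Sigma K) m
  (free_map k1 u1) (free_map k2 u1) (free_map k3 u2)).
rewrite !free_map_ternary !free_map_comp_apply.
have -> : kerpi1 (f := f) \o k1 = id by [].
have -> : kerpi2 (f := f) \o k3 = id by [].
rewrite !free_map_id; split.
  have -> : kerpi1 (f := f) \o k2 = e by [].
  have -> : kerpi1 (f := f) \o k3 = e by [].
  by rewrite -eu; have [] := mP _ VA u1 (free_map e u1).
have -> : kerpi2 (f := f) \o k1 = e by [].
have -> : kerpi2 (f := f) \o k2 = e by [].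
by have [] := mP _ VA (free_map e u1) u2.
Qed.
End FreeMap.

Section Permutability.
Variables (S : signature) (Sigma : set (equation S)).
Local Notation F := (free Sigma).

(** If x Theta y Psi z, then x = m(x,y,y) Psi m(x,y,z) Theta m(y,y,z) = z. *)
Lemma malcev_alternating (m : term S 'I_3) (A : algebra S)
    (Theta Psi : set (A * A)) :
  (forall x y : A, ternary m x y y = x /\ ternary m x x y = y) ->
  congruence Theta -> congruence Psi ->
  alternating 2 Theta Psi `<=` alternating 2 Psi Theta.
Proof.
move=> mP cT cP [x z] [y /= xy yz].
have tern (R : set (A * A)) a b c a' b' c' : congruence R ->
    R (a, a') -> R (b, b') -> R (c, c') ->
    R (ternary m a b c, ternary m a' b' c').
  move=> cR aa bb cc; rewrite /ternary.
  elim: m {mP} => [i | g ts IH] /=; last by apply: (congr_compat cR).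
  by rewrite !(tnth_nth a); case: i => -[|[|[|//]]].
exists (ternary m x y z) => /=.
  rewrite -[X in Psi (X, _)](proj1 (mP x y)).
  by apply: (tern _ _ _ _ _ _ _ cP _ _ yz); exact: (congr_refl cP).
rewrite -[X in Theta (_, X)](proj2 (mP y z)).
by apply: (tern _ _ _ _ _ _ _ cT xy); exact: (congr_refl cT).
Qed.

Lemma malcev_permutable2 : malcev Sigma -> permutable Sigma 2.
Proof.
move=> [m mP] A VA Theta Psi cT cP.
by apply/seteqP; split; apply: (malcev_alternating (mP A VA)).
Qed.

(** * Steps between binary terms *)

Definition step (s t : F bool) : Prop :=
  exists p : F 'I_3, free_map merge_right p = s /\ free_map merge_left p = t.

(** Equality in the free algebra over two generators is an identity in two variables, so a
    representative of [p] is a Mal'cev term. *)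
Lemma step_malcev :
  step (free_class Sigma (Var false)) (free_class Sigma (Var true)) ->
  malcev Sigma.
Proof.
move=> [p [pr pl]]; exists (free_repr p) => A VA x y.
pose v (b : bool) : A := if b then y else x.
have vE a b c : ternary (free_repr p) (v a) (v b) (v c) =
    eval (v \o tnth [tuple a; b; c]) (free_repr p).
  by rewrite comp_tnth3.
split.
  apply: (etrans (vE false true true)).
  by move/free_classP/(_ A VA v): pr; rewrite eval_rename.
apply: (etrans (vE false false true)).
by move/free_classP/(_ A VA v): pl; rewrite eval_rename.
Qed.

Lemma step_refl s : step s s.
Proof.
(* The middle variable stays out of the ternary term, so both merges give back [s]. *)
pose h (b : bool) : 'I_3 := if b then inord 2 else inord 0.
exists (free_map h s); rewrite !free_map_comp_apply.
have [r0 _ r2] := tnth3 false true true.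
have [l0 _ l2] := tnth3 false false true.
by split; rewrite -[RHS](congr1 (@^~ s) (free_map_id Sigma bool));
  congr free_map; apply/funext => -[] /=;
  rewrite /merge_right /merge_left ?r0 ?r2 ?l0 ?l2.
Qed.

Lemma step_trans s t u :
  weakly_preserves_kernel_pairs (free_functor Sigma) ->
  step s t -> step t u -> step s u.
Proof.
move=> wp [p [<- <-]] [q [pq <-]].
(* Let x, y, z, t be the four pairs, in lexicographic order.  Lifting p(x,y,z)
   and q(x,z,t) to the kernel pair of [fst] gives a term w in the variables
   xx, xy, yx, yy, zz, zt, tz, tt, and w(x,x,y,y,y,z,y,z) does both steps. *)
pose a := tnth [tuple (false, false); (false, true); (true, false)].
pose b := tnth [tuple (false, false); (true, false); (true, true)].
have fab : free_map fst (free_map a p) = free_map fst (free_map b q).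
  by rewrite !free_map_comp_apply !comp_tnth3 -[LHS]pq.
have [w /= [wa wb]] :=
  wp _ _ (@fst bool bool) (free_map a p) (free_map b q) fab.
pose h (k : kernel_pair (@fst bool bool)) : 'I_3 :=
  if (kerpi1 k).1 then if (kerpi2 k).2 then inord 2 else inord 1
  else if (kerpi1 k).2 then inord 1 else inord 0.
have [r0 r1 r2] := tnth3 false true true.
have [l0 l1 l2] := tnth3 false false true.
exists (free_map h w); split; rewrite free_map_comp_apply.
  (* [orb] after [a] is [merge_right]; below, [andb] after [b] is [merge_left]. *)
  transitivity (free_map (uncurry orb) (free_map a p)).
    rewrite -wa free_map_comp_apply; congr free_map.
    apply/funext => -[[[[] []] [[] []]] //= _];
    by rewrite /merge_right /h /= ?r0 ?r1 ?r2.
  by rewrite free_map_comp_apply comp_tnth3.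
transitivity (free_map (uncurry andb) (free_map b q)).
  rewrite -wb free_map_comp_apply; congr free_map.
  apply/funext => -[[[[] []] [[] []]] //= _];
  by rewrite /merge_left /h /= ?l0 ?l1 ?l2.
by rewrite free_map_comp_apply comp_tnth3.
Qed.

(** * The Hagemann-Mitschke chain *)

Definition merge (b : bool) (j : nat) : nat := (b + j)./2.

(** The blocks of [merge false] are 01, 23, ..., those of [merge true] are 0, 12, 34, ...; the two
    kernels link successive generators in turn. *)
Definition merge_ker (b : bool) : set (F nat * F nat) :=
  [set p | free_map (merge b) p.1 = free_map (merge b) p.2].

Definition cut (i j : nat) : bool := i < j.

Lemma merge_ker_congruence b :
  @congruence S (free_algebra Sigma nat) (merge_ker b).
Proof.
split; rewrite /merge_ker /=.
- by [].
- by move=> x y ->.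
- by move=> x y z -> ->.
- move=> f c d cd.
  have E (x : 'I_(arity f) -> F nat) : free_map (merge b) (free_class Sigma
      (App f (fun i => free_repr (x i)))) =
      @interp S (free_algebra Sigma nat) f (free_map (merge b) \o x).
    exact: (free_map_eval (merge b)
      (x : 'I_(arity f) -> free_algebra Sigma nat) (App f (@Var S _))).
  by rewrite /= !E; congr (@interp S (free_algebra Sigma nat) f _); apply/funext.
Qed.

(* [merge b] identifies [i] with [i.+1] only when [odd i = b], so it respects
   the cut between [i] and [i.+1] when [odd i = ~~ b]. *)
Lemma merge_ker_cut i u v :
  merge_ker (~~ odd i) (u, v) ->
  free_map (cut i) u = free_map (cut i) v.
Proof.
have -> : cut i = cut (merge (~~ odd i) i) \o merge (~~ odd i).
  apply/funext => j; rewrite /cut /merge /= ltnNge [RHS]ltnNge leq_half_double.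
  (* An odd sum makes [i] the last element of its block. *)
  have odd_sum : odd (~~ odd i + i) by rewrite oddD oddb addNb addbb.
  have -> : (~~ odd i + i)./2.*2.+1 = ~~ odd i + i.
    by rewrite -[RHS]odd_double_half odd_sum.
  by rewrite leq_add2l.
by rewrite /merge_ker free_map_comp /= => ->.
Qed.

(** Only the variable [i.+1] changes sides between the two cuts; it becomes the middle variable. *)
Lemma step_cut i u : step (free_map (cut i) u) (free_map (cut i.+1) u).
Proof.
pose h (j : nat) : 'I_3 :=
  if j <= i then inord 0 else if j <= i.+1 then inord 1 else inord 2.
have [r0 r1 r2] := tnth3 false true true.
have [l0 l1 l2] := tnth3 false false true.
exists (free_map h u); rewrite !free_map_comp_apply.
split; congr free_map; apply/funext => j.
  rewrite /cut /merge_right /h /= ltnNge.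
  by case: (j <= i); case: (j <= i.+1); rewrite ?r0 ?r1 ?r2.
rewrite /cut /merge_left /h /= [RHS]ltnNge.
have [ji|_] := leqP j i; first by rewrite leqW ?l0.
by case: (j <= i.+1); rewrite ?l1 ?l2.
Qed.

(** Each of the [m] intermediate elements gives one step, by moving the cut; neighbouring elements
    agree under the cut that their congruence respects. *)
Lemma alternating_step m i u v :
  alternating m.+1 (merge_ker (~~ odd i)) (merge_ker (odd i)) (u, v) ->
  exists s : nat -> F bool,
    [/\ s 0 = free_map (cut i) u, s m = free_map (cut (i + m)) v
      & forall k, k < m -> step (s k) (s k.+1)].
Proof.
elim: m i u => [|m IH] i u.
  move=> /merge_ker_cut uv; exists (fun=> free_map (cut i) u).
  by rewrite addn0.
case=> w /= /merge_ker_cut uw wv.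
have [|s [s0 sm sS]] := IH i.+1 w; first by rewrite /= negbK.
exists (fun k => if k is k'.+1 then s k' else free_map (cut i) u).
split=> // [|[_|k]]; first by rewrite sm addSnnS.
  by rewrite s0 uw; apply: step_cut.
exact: sS.
Qed.

Lemma generators_alternating m i :
  alternating m (merge_ker (odd i)) (merge_ker (~~ odd i))
    (free_class Sigma (Var i), free_class Sigma (Var (i + m))).
Proof.
elim: m i => [|m IH] i; first by rewrite addn0.
have base : merge_ker (odd i)
    (free_class Sigma (Var i), free_class Sigma (Var i.+1)).
  rewrite /merge_ker /= !free_mapE /= /merge; congr (free_class _ (Var _)).
  by rewrite addnS /= uphalf_half oddD oddb addbb.
case: m IH => [|m] IH; first by rewrite addn1.
exists (free_class Sigma (Var i.+1)) => //.
by have := IH i.+1; rewrite /= negbK addSnnS.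
Qed.

(** The generators 0 to [m.+1] form a chain that starts with [merge_ker false]; permutability gives
    one that starts with [merge_ker true], which respects [cut 0]. *)
Lemma permutable_step m : permutable Sigma m.+1 ->
  exists s : nat -> F bool,
    [/\ s 0 = free_class Sigma (Var false), s m = free_class Sigma (Var true)
      & forall k, k < m -> step (s k) (s k.+1)].
Proof.
move=> perm; have := generators_alternating m.+1 0.
rewrite (perm (free_algebra Sigma nat) (@free_algebra_variety _ _ _)
  _ _ (merge_ker_congruence _) (merge_ker_congruence _)).
case/(@alternating_step m 0) => s [s0 sm sS].
by exists s; rewrite s0 sm !free_mapE /= /cut !add0n ltnSn.
Qed.

Lemma permutable2_malcev : permutable Sigma 2 -> malcev Sigma.
Proof.
by move=> /permutable_step [s [s0 s1 sS]]; apply: step_malcev;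
  rewrite -s0 -s1; apply: sS.
Qed.

Lemma wpkp_permutable_malcev n :
  weakly_preserves_kernel_pairs (free_functor Sigma) ->
  permutable Sigma n.+1 -> malcev Sigma.
Proof.
move=> wp /permutable_step [s [s0 sn sS]]; apply: step_malcev.
(* The chain is folded from its far end, with the empty chain as base case. *)
rewrite -s0 -sn; elim: n {sn} sS => [|n IH] sS; first exact: step_refl.
apply: (step_trans wp) (sS n (ltnSn n)).
by apply: IH => k kn; apply: sS; apply: ltnW.
Qed.

End Permutability.

Theorem theorem10 (S : signature) (Sigma : set (equation S)) (n : nat)
    (hn : 2 <= n) (hperm : permutable Sigma n) :
  (weakly_preserves_kernel_pairs (free_functor Sigma) <-> malcev Sigma) /\
  (malcev Sigma <-> permutable Sigma 2).
Proof.
split; split.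
- by case: n hn hperm => // n _ perm wp; apply: wpkp_permutable_malcev wp perm.
- exact: malcev_wpkp.
- exact: malcev_permutable2.
- exact: permutable2_malcev.
Qed.
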